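(* Let $H = (V,E)$ be a hypertree such that $|e|$ is prime for each $e \in E$. Then the chromatic symmetric function $X_H$ is $F$-positive.
   Context: A hypergraph is a pair $H=(V,E)$ with $V$ finite and $E$ a family of subsets of $V$ with $|e|>1$ for each $e\in E$. A path is a sequence $v_1, e_1, v_2, \ldots, e_m, v_{m+1}$ with $e_i \in E$, $v_i, v_{i+1} \in e_i$, the edges distinct and the vertices distinct except that $v_1 = v_{m+1}$ is allowed; if $v_1 = v_{m+1}$ and $m>1$ it is a cycle. A hypertree is a connected (any two vertices joined by a path) hypergraph with no cycles. A coloring $\chi: V \to \mathbb{P}=\{1,2,\ldots\}$ is proper if no edge is monochromatic (i.e. $\chi$ is nonconstant on each $e\in E$). $X_H = \sum_\chi \prod_{v \in V} x_{\chi(v)}$, summed over proper colorings, a symmetric function in commuting variables $x_1,x_2,\ldots$. With $n=|V|$, for $S \subseteq [n-1]$ the fundamental quasisymmetric function is $F_S = \sum x_{i_1}\cdots x_{i_n}$ over all $i_1 \le \cdots \le i_n$ in $\mathbb{P}$ with $i_j < i_{j+1}$ whenever $j \in S$. $X_H$ is $F$-positive if all coefficients in its expansion $X_H = \sum_S a_S F_S$ are nonnegative. *)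

(* Defs.v *)
From HB Require Import structures.
From mathcomp Require Import all_boot all_order all_algebra.
From mathcomp Require Import mpoly.
Set Implicit Arguments. Unset Strict Implicit. Unset Printing Implicit Defensive.
Import Order.TTheory GRing.Theory Num.Theory.
Local Open Scope ring_scope.

Definition hypergraph (V : finType) (E : {set {set V}}) : Prop :=
  forall e, e \in E -> (1 < #|e|)%N.

(* A path v_1, e_1, v_2, ..., e_m, v_(m+1) is encoded by vs = [v_1;..;v_(m+1)]
   and es = [e_1;..;e_m] (0-based indices in the sequences). *)
Definition is_path (V : finType) (E : {set {set V}})
    (vs : seq V) (es : seq {set V}) : Prop :=
  [/\ size vs = (size es).+1,
      all (fun e => e \in E) es,
      uniq es,
      (forall (x0 : V) i, (i < size es)%N ->
         nth x0 vs i \in nth set0 es i /\ nth x0 vs i.+1 \in nth set0 es i)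
    & (* vertices distinct, except that v_1 = v_(m+1) is allowed *)
      forall (x0 : V) i j, (i < j)%N -> (j < size vs)%N ->
         nth x0 vs i = nth x0 vs j -> i = 0%N /\ j = size es].

Definition is_cycle (V : finType) (E : {set {set V}})
    (vs : seq V) (es : seq {set V}) : Prop :=
  exists v, [/\ is_path E vs es, head v vs = last v vs & (1 < size es)%N].

Definition connected_hg (V : finType) (E : {set {set V}}) : Prop :=
  forall u v : V, exists vs es,
    [/\ is_path E vs es, head u vs = u & last u vs = v].

Definition hypertree (V : finType) (E : {set {set V}}) : Prop :=
  [/\ hypergraph E, connected_hg E & forall vs es, ~ is_cycle E vs es].

Definition proper_col (V : finType) (E : {set {set V}}) (N : nat)
    (chi : {ffun V -> 'I_N}) : bool :=
  [forall e in E, exists u in e, exists w in e, chi u != chi w].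

(* X_H truncated to the N variables x_1..x_N (colour k : 'I_N is colour k+1). *)
Definition XH (V : finType) (E : {set {set V}}) (N : nat) : {mpoly int[N]} :=
  \sum_(chi : {ffun V -> 'I_N} | proper_col E chi) \prod_(v : V) 'X_(chi v).

(* Fundamental quasisymmetric function F_S of degree n in N variables.
   S : {set 'I_n.-1}; the element s encodes s+1 in [n-1], i.e. the paper's set
   is {s+1 | s in S}.  A sequence i_1 <= ... <= i_n is t : {ffun 'I_n -> 'I_N},
   with t j = i_(j+1); position j+1 in the paper is 0-based j here. *)
Definition Fq (n N : nat) (S : {set 'I_n.-1}) : {mpoly int[N]} :=
  \sum_(t : {ffun 'I_n -> 'I_N} |
          [forall j : 'I_n, forall k : 'I_n, (val k == (val j).+1) ==>
             ((t j <= t k)%N &&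
              ([exists s in S, val s == val j] ==> (t j < t k)%N))])
    \prod_(j : 'I_n) 'X_(t j).

(* Main.v *)
Require Import Defs.
From HB Require Import structures.
From mathcomp Require Import all_boot all_order all_algebra.
From mathcomp Require Import mpoly zify.
Set Implicit Arguments. Unset Strict Implicit. Unset Printing Implicit Defensive.
Import Order.TTheory GRing.Theory Num.Theory.
Local Open Scope ring_scope.

(** Read a coloring of an edge [e] of prime size [p] as a cyclic word.  Rotating
    the word by one position changes its major index modulo [p] by its number of
    cyclic descents, which lies strictly between [0] and [p] unless the word is
    constant.  Hence exactly one rotation of a nonconstant word, and none of a
    constant word, has major index 1 modulo [p], so the proper colorings are split
    according to the rotation [r e] that this singles out on each edge.

    As the hypergraph has no cycles, the rotated orders of the edges extend to one
    linear order [om] of the vertices.  Membership in the class of [r] depends only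
    on the descents of the coloring along [om] within the edges, hence only on its
    standardization with respect to [om].  The colorings with a given
    standardization [s] sum to [F_(Des s)]. *)

(** * Connectivity without cycles, and gluing of edge orders *)

Section Gluing.
Variable V : finType.
Implicit Types (E : {set {set V}}) (e : {set V}) (u v w : V).
Local Open Scope nat_scope.

(** The bipartite incidence graph, a path of which alternates between vertices and edges. *)
Definition incident E (a b : V + {set V}) : bool :=
  match a, b with
  | inl v, inr e | inr e, inl v => (e \in E) && (v \in e)
  | _, _ => false
  end.

Definition joined E u v := connect (incident E) (inl u) (inl v).

Lemma joined_sym E u v : joined E u v = joined E v u.
Proof. by apply: sym_connect_sym => [] [x|e] [y|f]. Qed.

Lemma joined_edge E e u v : e \in E -> u \in e -> v \in e -> joined E u v.
Proof.
move=> eE ue ve; apply: (@connect_trans _ _ (inr e)); apply: connect1;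
by rewrite /= eE.
Qed.

Definition vertex_of (a : V + {set V}) := if a is inl v then Some v else None.
Definition edge_of (a : V + {set V}) := if a is inr e then Some e else None.

Lemma incident_path E u v p : path (incident E) (inl u) p -> last (inl u) p = inl v ->
  let vs := pmap vertex_of p in let es := pmap edge_of p in
  [/\ size vs = size es, all (fun e => e \in E) es, last u vs = v &
   forall (x0 : V) i, i < size es ->
     nth x0 (u :: vs) i \in nth set0 es i /\ nth x0 vs i \in nth set0 es i].
Proof.
(* A walk between vertices is consumed two steps at a time, an edge and then a vertex; hence the
   explicit [fix]. *)
move: p u; fix IH 1 => [[|[x|e] [|[w|f] p]]] u //=; first by move=> _ [->].
2: by rewrite andbF.
case/and3P=> /andP[eE ue] /andP[_ we] pp lp.
have [/= -> -> -> Hn] := IH p w pp lp.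
split=> //; first by rewrite eE.
by move=> x0 [|i] //=; apply: Hn.
Qed.

(** A simple path from [u] to [v] that avoids [e] is closed up by [e] itself. *)
Lemma joined_cycle E e u v : e \in E -> u \in e -> v \in e -> u != v ->
  joined (E :\ e) u v -> exists vs es, is_cycle E vs es.
Proof.
move=> eE ue ve uv /connectP[p0 pp0 lp0].
case: (shortenP pp0) lp0 => p pp up _ /esym lp.
have [/=] := incident_path pp lp.
have: uniq (u :: pmap vertex_of p).
  by apply: (@pmap_uniq _ _ vertex_of inl _ (inl u :: p)); [case | ].
have: uniq (pmap edge_of p).
  by apply: (@pmap_uniq _ _ edge_of inr _ p); [case | case/andP: up].
move: (pmap edge_of p) (pmap vertex_of p) => es vs ues uvs svs aes lvs nvs.
exists (rcons (u :: vs) u), (rcons es e), u; split; first split.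
- by rewrite !size_rcons /= svs.
- rewrite all_rcons eE; apply: sub_all aes => f; by rewrite inE => /andP[].
- rewrite rcons_uniq ues andbT; apply/negP => /(allP aes).
  by rewrite !inE eqxx.
- move=> x0 i; rewrite size_rcons ltnS !nth_rcons /= svs => le_i.
  have -> : i < (size es).+1 by lia.
  rewrite eqSS ltnS; case: ltngtP le_i => // [lt_i _|-> _]; first exact: nvs.
  split=> //; rewrite -svs -[nth _ _ _]/(nth x0 (u :: vs) (size (u :: vs)).-1).
  by rewrite nth_last /= lvs.
- move=> x0 i j lt_ij; rewrite !size_rcons !nth_rcons /= ltnS => le_j.
  have -> : i < (size vs).+1 by lia.
  case: ltngtP le_j => // [lt_j _|eq_j _].
    move/eqP; rewrite (@nth_uniq _ x0 (u :: vs)) //=; lia.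
  rewrite -[u in RHS]/(nth x0 (u :: vs) 0).
  move/eqP; rewrite (@nth_uniq _ x0 (u :: vs)) //=; lia.
- by rewrite /= last_rcons.
- rewrite size_rcons ltnS -svs; case: (vs) lvs => //= uv'.
  by rewrite uv' eqxx in uv.
Qed.

(* Deleting an edge [e] leaves its vertices in distinct components; reordering
   these components according to [rk e] extends an order that works for the
   remaining edges. *)
Lemma glue_orders E (rk : {set V} -> V -> nat) :
  (forall vs es, ~ is_cycle E vs es) ->
  exists2 om : V -> nat, injective om &
    forall e u v, e \in E -> u \in e -> v \in e -> rk e u < rk e v -> om u < om v.
Proof.
have [m] := ubnP #|E|; elim: m E => // m IH E cE acyc.
have [->|[e eE]] := set_0Vmem E.
  exists (fun v => nat_of_ord (enum_rank v)) => [u v /val_inj/enum_rank_inj //|e u v].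
  by rewrite inE.
have sub : E :\ e \subset E by exact: subsetDl.
have [|vs es [v [[p1 p2 p3 p4 p5] hv sv]]|om om_inj omP] := IH (E :\ e).
- by rewrite (cardsD1 e) eE in cE; lia.
- apply: (acyc vs es); exists v; split=> //; split=> //.
  by apply: sub_all p2 => f /(subsetP sub).
(* By acyclicity the component of [v] contains at most one vertex of [e], whose rank becomes that of
   the component; components missing [e] get [0]. *)
pose c v := if [pick u in e | joined (E :\ e) u v] is Some u then rk e u else 0.
have c_e u : u \in e -> c u = rk e u.
  move=> ue; rewrite /c; case: pickP => [w /andP[we wu]|/(_ u)].
    have [->//|neq] := eqVneq w u.
    by have [vs [es /acyc]] := joined_cycle eE we ue neq wu.
  by rewrite ue /joined connect0.
have c_f f u v : f \in E :\ e -> u \in f -> v \in f -> c u = c v.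
  move=> fE uf vf; rewrite /c (@eq_pick _ _ (fun w => (w \in e) && joined (E :\ e) w v)) // => w.
  congr (_ && _); have uv := joined_edge fE uf vf.
  have vu : joined (E :\ e) v u by rewrite joined_sym.
  by apply/idP/idP => h; apply: connect_trans h _.
pose M := (\max_v om v).+1.
have om_lt v : om v < M by rewrite ltnS; apply: leq_bigmax.
(* As [om v < M], this encodes the lexicographic order on pairs [(c v, om v)]. *)
exists (fun v => c v * M + om v) => [u v|f u v fE uf vf lt_uv].
  move=> /(congr1 (modn^~ M)); rewrite !modnMDl !modn_small // => /om_inj //.
have [fe|nfe] := eqVneq f e.
  rewrite {f}fe in fE uf vf lt_uv; rewrite !c_e //.
  have := om_lt u; nia.
have fE' : f \in E :\ e by rewrite !inE nfe.
by rewrite (c_f _ _ _ fE' uf vf) ltn_add2l (omP f).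
Qed.
End Gluing.

(** * Cyclic descents and the major index of rotations *)

Section CyclicDescents.
Local Open Scope nat_scope.
Variables (p : nat) (x : 'I_p -> nat).

Definition cdes (i : 'I_p) : bool := x (ordS i) < x i.

Lemma sum_ordS : \sum_i x (ordS i) = \sum_i x i.
Proof. by rewrite [RHS](reindex_inj (@ordS_inj p)). Qed.

Lemma ordS_const : (forall i, x (ordS i) = x i) -> forall i j, x i = x j.
Proof.
move=> H i0 j0; have p_gt0 : 0 < p by apply: leq_ltn_trans (ltn_ord i0).
suff H0 i : x i = x (Ordinal p_gt0) by rewrite !H0.
case: i => m; elim: m => [|m IH] lt_m; first by congr x; apply: val_inj.
rewrite -(IH (ltnW lt_m)) -[RHS]H; congr x; apply: val_inj => /=.
by rewrite modn_small.
Qed.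

(** Without cyclic descents [x] increases weakly around the circle; as the rotated word has the same
    sum, every step is an equality. *)
Lemma cdes_gt0 i j : x i != x j -> 0 < \sum_i cdes i.
Proof.
apply: contraR; rewrite -eqn0Ngt sum_nat_eq0 => /forallP H; apply/eqP.
apply: ordS_const => l.
have le_x k : x k <= x (ordS k).
  by have := H k; rewrite /= eqb0 /cdes -leqNgt.
have /leqif_sum /= : forall k, true -> x k <= x (ordS k) ?= iff (x k == x (ordS k)).
  by move=> k _; split.
by case=> _; rewrite sum_ordS eqxx => /esym/forallP/(_ l)/= /eqP.
Qed.

(** A descent at every position would make the sum of the rotated word strictly smaller. *)
Lemma cdes_ltp : 0 < p -> \sum_i cdes i < p.
Proof.
move=> p_gt0; rewrite ltnNge; apply/negP => le_p.
have all_des i : cdes i.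
  apply: contraLR le_p => /negbTE nd; rewrite -ltnNge (bigD1 i) //= nd add0n.
  apply: leq_ltn_trans (_ : \sum_(j < p | j != i) 1 < p).
    by apply: leq_sum => j _; case: cdes.
  by have := cardC1 i; rewrite sum1_card card_ord => ->; rewrite prednK.
have : \sum_i x (ordS i) < \sum_i x i; last by rewrite sum_ordS ltnn.
rewrite (bigD1 (Ordinal p_gt0)) //= [X in _ < X](bigD1 (Ordinal p_gt0)) //=.
rewrite -addSn leq_add ?all_des //; first exact: all_des.
by apply: leq_sum => j _; apply/ltnW/all_des.
Qed.

(* The major index, modulo [p], of the word [x] rotated so that it starts in
   position [p - k]; the descent from the last letter back to the first one has
   weight [0]. *)
Definition rot_maj (k : nat) := (\sum_i cdes i * ((i + k).+1 %% p)) %% p.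

Lemma rot_majE k : rot_maj k = (\sum_i cdes i * i.+1 + k * \sum_i cdes i) %% p.
Proof.
rewrite big_distrr /= -big_split /= /rot_maj -modn_summ -[RHS]modn_summ.
congr (_ %% _); apply: eq_bigr => i _.
by rewrite modnMmr; congr (_ %% _); lia.
Qed.

Lemma rot_maj_const k : 1 < p -> (forall i j, x i = x j) -> rot_maj k != 1.
Proof.
move=> p_gt1 H; rewrite /rot_maj big1 ?mod0n // => i _.
by rewrite /cdes (H _ i) ltnn.
Qed.

(* Rotating by one position shifts the major index by the number of cyclic
   descents, which is prime to [p]. *)
Lemma rot_maj_unique i j : prime p -> x i != x j ->
  exists k : 'I_p, forall l : 'I_p, (rot_maj l == 1) = (l == k).
Proof.
move=> pr_p neq; have p_gt1 := prime_gt1 pr_p; have p_gt0 := prime_gt0 pr_p.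
have cop : coprime p (\sum_i cdes i).
  rewrite prime_coprime // gtnNdvd ?cdes_ltp //.
  exact: cdes_gt0 neq.
(* [f l] is the residue [rot_maj l]; an injective self-map of ['I_p] is onto, and [k] is the
   preimage of 1. *)
pose f (l : 'I_p) : 'I_p := Ordinal (ltn_pmod (\sum_i cdes i * i.+1 + l * \sum_i cdes i) p_gt0).
have f_inj : injective f.
  move=> a b; wlog le_ba : a b / b <= a.
    by move=> W; case: (leqP b a) => [/W//|/ltnW/W{}W /esym/W].
  move=> /(congr1 val)/eqP /=; rewrite eqn_modDl eqn_mod_dvd ?leq_mul2r ?le_ba ?orbT //.
  rewrite -mulnBl Gauss_dvdl // -eqn_mod_dvd // !modn_small // => /eqP.
  exact: val_inj.
have /codomP[k fk] := injF_onto f_inj (Ordinal p_gt1).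
exists k => l; rewrite -(inj_eq f_inj) -fk -val_eqE /=; by rewrite rot_majE.
Qed.
End CyclicDescents.

Local Notation nval f := (fun v => nat_of_ord (f v)).

(** * Standardization and fundamental quasisymmetric functions *)

Section Standardization.
Local Open Scope nat_scope.
Variables (V : finType) (n : nat).
Hypothesis card_V : #|V| = n.
Variable om : V -> nat.
Hypothesis om_inj : injective om.
Implicit Types (c : V -> nat) (u v w : V).

Definition lex c u v := (c u < c v) || (c u == c v) && (om u < om v).

Lemma lex_irr c v : lex c v v = false.
Proof. by rewrite /lex !ltnn andbF. Qed.

Lemma lex_trans c : transitive (lex c).
Proof. by rewrite /lex => v u w; lia. Qed.

Lemma lex_total c u v : u != v -> lex c u v || lex c v u.
Proof. by move=> /eqP uv; have : om u <> om v; [move/om_inj | rewrite /lex; lia]. Qed.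

Lemma std_subproof c v : #|[set u | lex c u v]| < n.
Proof.
rewrite -card_V -cardsT; apply: proper_card; rewrite properT; apply/eqP => /setP/(_ v).
by rewrite !inE lex_irr.
Qed.

Definition std c : {ffun V -> 'I_n} := [ffun v => Ordinal (std_subproof c v)].

Lemma std_lt c u v : (std c u < std c v) = lex c u v.
Proof.
have H a b : lex c a b -> std c a < std c b.
  move=> ab; rewrite !ffunE /=; apply: proper_card; apply/properP; split.
    by apply/subsetP => w; rewrite !inE => wa; apply: lex_trans wa ab.
  by exists a; rewrite inE ?lex_irr.
apply/idP/idP => [lt_uv|]; last exact: H.
have [Euv|/(lex_total c)/orP[//|/H]] := eqVneq u v; last by lia.
by rewrite Euv ltnn in lt_uv.
Qed.

Lemma std_inj c : injective (std c).
Proof.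
move=> u v Euv; apply/eqP/negPn/negP => /(lex_total c).
by rewrite -!std_lt Euv ltnn.
Qed.

(** Ties are ranked in the order of [om], so they create no descent along [om]. *)
Lemma std_desc c u v : om u < om v -> (std c v < std c u) = (c v < c u).
Proof. by rewrite std_lt /lex; lia. Qed.

(** By cardinality [s] is a bijection, so [s v] counts the vertices that [s] ranks below [v], as
    [std] does. *)
Lemma std_unique c (s : {ffun V -> 'I_n}) : injective s ->
  (forall u v, s u < s v -> lex c u v) -> std c = s.
Proof.
move=> s_inj H; have Hlex u v : lex c u v = (s u < s v).
  apply/idP/idP => [uv|]; last exact: H.
  case: ltngtP => // [/H vu|/val_inj/s_inj Euv].
    by have := lex_trans uv vu; rewrite lex_irr.
  by rewrite Euv lex_irr in uv.
apply/ffunP => v; apply: val_inj; rewrite ffunE /=.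
rewrite (eq_card (B := [set u | s u < s v])) => [|u]; last by rewrite !inE Hlex.
have [g sK gK] : bijective s by apply: inj_card_bij; rewrite ?card_ord ?card_V.
rewrite -(card_imset _ s_inj) -[RHS](card_ord (s v)).
have le_sv : s v <= n by apply: ltnW.
have widen_inj : injective (widen_ord le_sv) by move=> a b /(congr1 val) /= /val_inj.
rewrite -[RHS](card_imset _ widen_inj).
apply: eq_card => j; apply/imsetP/imsetP => [[u]|[k _ ->]].
  by rewrite inE => lt_uv ->; exists (Ordinal lt_uv) => //; apply: val_inj.
by exists (g (widen_ord le_sv k)); rewrite ?inE gK /=.
Qed.

(** The descent set of the word of [om]-values read in the order of increasing [s]. *)
Definition Des (s : {ffun V -> 'I_n}) : {set 'I_n.-1} :=
  [set j : 'I_n.-1 | [exists u, exists v, [&& s u == j :> nat, s v == j.+1 :> nat & om v < om u]]].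

Definition compatible N (S : {set 'I_n.-1}) (t : {ffun 'I_n -> 'I_N}) :=
  [forall j : 'I_n, forall k : 'I_n, (val k == (val j).+1) ==>
     ((t j <= t k) && ([exists s in S, val s == val j] ==> (t j < t k)))].

(** Both sides say that vertices of consecutive rank increase for [lex]: a tie in color is allowed
    exactly where [om] increases. *)
Lemma std_compatible N (s : {ffun V -> 'I_n}) (t : {ffun 'I_n -> 'I_N}) :
  injective s -> (std (fun v => t (s v)) == s) = compatible (Des s) t.
Proof.
move=> s_inj; have [g sK gK] : bijective s by apply: inj_card_bij; rewrite ?card_ord ?card_V.
apply/eqP/forallP => [Es j|H].
  apply/forallP => k; apply/implyP => /eqP /= kj.
  have : lex (fun v => t (s v)) (g j) (g k) by rewrite -std_lt Es !gK kj ltnSn.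
  rewrite /lex !gK => ltjk; apply/andP; split; first by lia.
  apply/implyP => /existsP[i /andP[]]; rewrite inE.
  move=> /existsP[u /existsP[v /and3P[/eqP su /eqP sv lt_vu]]] /eqP /= ij.
  have Eu : u = g j by apply: s_inj; apply: val_inj; rewrite gK /=; lia.
  have Ev : v = g k by apply: s_inj; apply: val_inj; rewrite gK /=; lia.
  by rewrite Eu Ev in lt_vu; lia.
apply: std_unique => // u v.
have step (j k : 'I_n) : k = j.+1 :> nat -> lex (fun v => t (s v)) (g j) (g k).
  move=> kj; have /forallP/(_ k) := H j.
  rewrite /= kj eqxx /= => /andP[le_jk /implyP lt_jk]; rewrite /lex !gK.
  (* On a tie [om] has to increase, since otherwise [j] is a descent and compatibility makes the
     inequality strict. *)
  case: ltngtP le_jk => //= Ejk _; rewrite ltnNge leq_eqVlt; apply/negP => /orP[/eqP|lt_kj].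
    by move/om_inj/(congr1 s); rewrite !gK => /(congr1 val) /=; lia.
  have lt_j : j < n.-1 by have := ltn_ord k; lia.
  have : t j < t k; last by rewrite Ejk ltnn.
  apply: lt_jk; apply/existsP; exists (Ordinal lt_j); rewrite inE eqxx andbT.
  by apply/existsP; exists (g j); apply/existsP; exists (g k); rewrite !gK kj !eqxx.
have chain d : forall j k : 'I_n, k = j + d.+1 :> nat -> lex (fun v => t (s v)) (g j) (g k).
  elim: d => [|d IH] j k kj; first by apply: step; lia.
  have lt_k : j + d.+1 < n by have := ltn_ord k; lia.
  apply: lex_trans (IH j (Ordinal lt_k) erefl) _; apply: step => /=; lia.
move=> lt_uv; have := chain (s v - (s u).+1) (s u) (s v); rewrite !sK; apply; lia.
Qed.

Lemma sum_std N (s : {ffun V -> 'I_n}) : injective s ->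
  (\sum_(chi : {ffun V -> 'I_N} | std (nval chi) == s) \prod_v 'X_(chi v) =
   Fq N (Des s) :> {mpoly int[N]})%R.
Proof.
move=> s_inj; have [g sK gK] : bijective s by apply: inj_card_bij; rewrite ?card_ord ?card_V.
(* Colorings correspond to sequences [t] through composition with the bijection [s]. *)
rewrite /Fq (reindex (fun t : {ffun 'I_n -> 'I_N} => [ffun v => t (s v)])) /=; last first.
  exists (fun chi : {ffun V -> 'I_N} => [ffun j => chi (g j)]) => t _.
    by apply/ffunP => j; rewrite !ffunE gK.
  by apply/ffunP => j; rewrite !ffunE sK.
apply: eq_big => t.
  rewrite -[RHS]/(compatible (Des s) t) -std_compatible //; congr (_ == _).
  apply: std_unique; first exact: std_inj.
  by move=> u v; rewrite std_lt /lex !ffunE.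
move=> _; rewrite [RHS](reindex s) /=; last by exists g => ? _.
by apply: eq_bigr => v _; rewrite ffunE.
Qed.
End Standardization.

(** * Classes of colorings given by edge rotations *)

Section EdgeRotations.
Variables (V : finType) (E : {set {set V}}).
Hypothesis E_prime : forall e, e \in E -> prime #|e|.
Local Open Scope nat_scope.

(** One codomain serves all edges, as [#|e| <= #|V|]; the successor provides [ord0]. *)
Definition rotations := {ffun {set V} -> 'I_#|V|.+1}.

Definition edge_maj (e : {set V}) (k : nat) (c : V -> nat) :=
  rot_maj (fun i : 'I_#|e| => c (enum_val i)) k.

(* [r] is pinned to [0] off [E] so that a proper coloring selects a unique [r]. *)
Definition selects (r : rotations) (c : V -> nat) :=
  [forall e, if e \in E then (r e < #|e|) && (edge_maj e (r e) c == 1) else r e == ord0].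

Lemma proper_selects N (chi : {ffun V -> 'I_N}) : proper_col E chi ->
  exists r0, forall r, selects r (nval chi) = (r == r0).
Proof.
move=> /forallP chiP.
have /fin_all_exists[r0 r0P] : forall e, exists k0 : 'I_#|V|.+1, forall k : 'I_#|V|.+1,
    (if e \in E then (k < #|e|) && (edge_maj e k (nval chi) == 1) else k == ord0) = (k == k0).
  move=> e; case eE: (e \in E); last by exists ord0.
  have /implyP/(_ eE)/existsP[u /andP[ue /existsP[w /andP[we uw]]]] := chiP e.
  have [|k kP] := @rot_maj_unique #|e| (fun i => nat_of_ord (chi (enum_val i)))
     (enum_rank_in ue u) (enum_rank_in ue w) (E_prime eE).
    by rewrite !enum_rankK_in.
  have lt_k : k < #|V|.+1 by have := ltn_ord k; have := max_card e; lia.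
  exists (Ordinal lt_k) => l; rewrite -val_eqE /=.
  case: (ltnP l #|e|) => [lt_l|le_l] /=.
    by rewrite -[val l]/(val (Ordinal lt_l)) val_eqE -kP.
  by apply/esym/eqP => /= El; have := ltn_ord k; rewrite -El ltnNge le_l.
exists [ffun e => r0 e] => r; apply/forallP/eqP => [H|-> e].
  by apply/ffunP => e; rewrite ffunE; apply/eqP; rewrite -r0P.
by rewrite r0P ffunE.
Qed.

Lemma selects_proper N (chi : {ffun V -> 'I_N}) r : selects r (nval chi) -> proper_col E chi.
Proof.
move=> /forallP H; apply/forallP => e; apply/implyP => eE.
have := H e; rewrite eE => /andP[_]; apply: contraTT => /existsPn nc.
apply: rot_maj_const => [|i j]; first exact/prime_gt1/E_prime.
have := nc (enum_val i); rewrite enum_valP /= => /existsPn/(_ (enum_val j)).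
by rewrite enum_valP /= negbK => /eqP ->.
Qed.

(** Except at the wrap-around, cyclic neighbors in an edge are ordered by [om], so standardization
    preserves the descents between them. *)
Lemma selects_std n (card_V : #|V| = n) (r : rotations) (om : V -> nat) c : injective om ->
  (forall (e : {set V}) (i j : 'I_#|e|), e \in E -> (i + r e) %% #|e| < (j + r e) %% #|e| ->
     om (enum_val i) < om (enum_val j)) ->
  selects r c = selects r (nval (std card_V om c)).
Proof.
move=> om_inj omP; apply: eq_forallb => e; case: ifP => // eE; congr (_ && (_ == _)).
congr (_ %% _); apply: eq_bigr => i _.
(* The wrap-around, where the order of [om] is reversed, has weight [0]. *)
have [->|nz] := eqVneq ((i + r e).+1 %% #|e|) 0; first by rewrite !muln0.
congr (nat_of_bool _ * _); rewrite /cdes std_desc //; apply: omP => //=.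
rewrite modnDml addSn -[X in _ < X]/((i + r e).+1 %% #|e|).
have := modnS (i + r e) #|e|; rewrite /dvdn (negbTE nz) => ->; exact: ltnSn.
Qed.

Lemma selected_F_positive r : (forall vs es, ~ is_cycle E vs es) ->
  exists a : {set 'I_(#|V|).-1} -> int, (forall S, 0 <= a S)%R /\ forall N,
  (\sum_(chi : {ffun V -> 'I_N} | selects r (nval chi)) \prod_v 'X_(chi v) =
   \sum_(S : {set 'I_(#|V|).-1}) a S *: Fq N S :> {mpoly int[N]})%R.
Proof.
move=> acyc.
have [om om_inj omP] := glue_orders (fun e v => (index v (enum e) + r e) %% #|e|) acyc.
have stdP c : selects r c = selects r (nval (std (erefl #|V|) om c)).
  apply: selects_std => // e i j eE lt_ij; apply: (omP e); rewrite ?enum_valP //.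
  by rewrite !(enum_val_nth (enum_default i)) !index_uniq ?enum_uniq -?cardE.
pose good (s : {ffun V -> 'I_#|V|}) := injectiveb s && selects r (nval s).
(* The coefficient counts the standardizations in the class of [r] with descent set [S],
   independently of [N]. *)
exists (fun S => (\sum_(s | good s && (Des om s == S)) 1)%R); split => [S|N].
  exact: sumr_ge0.
transitivity (\sum_(s | good s) Fq N (Des om s))%R; last first.
  rewrite (partition_big (Des om) predT) //=; apply: eq_bigr => S _.
  rewrite scaler_suml; apply: eq_bigr => s /andP[_ /eqP <-]; by rewrite scale1r.
rewrite (partition_big (fun chi : {ffun V -> 'I_N} => std (erefl #|V|) om (nval chi)) good) /=; last first.
  by move=> chi; rewrite stdP /good => ->; rewrite andbT; apply/injectiveP/std_inj.
apply: eq_bigr => s /andP[/injectiveP s_inj sel]; rewrite -sum_std //.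
apply: eq_bigl => chi; case: eqP => [Es|]; rewrite ?andbF // andbT stdP Es //.
Qed.
End EdgeRotations.

(** * Summation over all choices of rotations *)

Theorem theorem3p3 (V : finType) (E : {set {set V}}) :
  hypertree E ->
  (forall e, e \in E -> prime #|e|) ->
  exists a : {set 'I_(#|V|).-1} -> int,
    (forall S, 0 <= a S) /\
    (forall N : nat, XH E N = \sum_(S : {set 'I_(#|V|).-1}) a S *: Fq N S).
Proof.
move=> [_ _ acyc] E_prime.
have /fin_all_exists[a aP] := fun r => selected_F_positive r acyc.
exists (fun S => \sum_r a r S); split => [S|N].
  by apply: sumr_ge0 => r _; have [] := aP r.
transitivity (\sum_(r : rotations V) \sum_(S : {set 'I_(#|V|).-1}) a r S *: Fq N S).
  transitivity (\sum_r \sum_(chi : {ffun V -> 'I_N} | selects E r (nval chi))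
                  \prod_v 'X_(chi v) : {mpoly int[N]}).
    (* Each proper coloring lies in exactly one class, and every class consists of proper
       colorings. *)
    rewrite (exchange_big_dep (proper_col E (N:=N))) /=; last first.
      by move=> r chi _; apply: selects_proper.
    apply: eq_bigr => chi /(proper_selects E_prime)[r0 r0P].
    by rewrite (eq_bigl _ _ r0P) big_pred1_eq.
  by apply: eq_bigr => r _; have [_] := aP r.
by rewrite exchange_big; apply: eq_bigr => S _; rewrite scaler_suml.
Qed.
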